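(* Let $K\subseteq\mathbb R^p$ be a centrally symmetric, sign-invariant and permutation-invariant convex body, and let $1\le s\le p$. Then, for every $z\in\mathbb R^p$, $$h_{K^{(s)}}(z):=\sup_{v\in K^{(s)}}\langle z,v\rangle=\max_{|T|\le s}\|z_T\|_{K^\circ}=\|z_{T_s(z)}\|_{K^\circ}.$$ Consequently, $$(K^{(s)})^\circ=\{z\in\mathbb R^p:\|z_{T_s(z)}\|_{K^\circ}\le1\}.$$ If, in addition, $rB_2^p\subseteq K\subseteq RB_2^p$ for some $0<r\le R<\infty$, then $$\frac1RB_2^p\subseteq(K^{(s)})^\circ\subseteq\frac1r\sqrt{\frac ps}\,B_2^p.$$ Thus $(K^{(s)})^\circ$ is well-balanced, with Euclidean aspect ratio at most $(R/r)\sqrt{p/s}$.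
   Context: A convex body is a compact convex set with nonempty interior. $K$ is sign-invariant and permutation-invariant if $(\varepsilon_1x_{\pi(1)},\dots,\varepsilon_px_{\pi(p)})\in K$ for all $x\in K$, all signs $\varepsilon_j\in\{-1,1\}$ and all permutations $\pi$ of $\{1,\dots,p\}$. $K^{(s)}=\operatorname{conv}\{v\in K:\|v\|_0\le s\}$, where $\|v\|_0$ is the number of nonzero entries. The polar of $C\subseteq\mathbb R^p$ is $C^\circ=\{y:\langle x,y\rangle\le1\ \forall x\in C\}$, and $\|y\|_{K^\circ}=\inf\{t>0:y\in tK^\circ\}=\sup_{x\in K}\langle x,y\rangle$ is the gauge of $K^\circ$. $B_2^p$ is the unit Euclidean ball. For $T\subseteq\{1,\dots,p\}$, $z_T\in\mathbb R^p$ agrees with $z$ on $T$ and is zero off $T$; $T_s(z)$ is the set of indices of the $s$ largest coordinates of $z$ in absolute value, with deterministic tie-breaking. The Euclidean aspect ratio at most $\rho$ means that the set lies between two centered Euclidean balls whose radii have ratio at most $\rho$. *)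

(* Defs.v *)
From HB Require Import structures.
From mathcomp Require Import all_boot all_order all_algebra all_fingroup.
From mathcomp Require Import all_classical all_reals all_analysis.
Import Order.TTheory GRing.Theory Num.Theory.
Import numFieldNormedType.Exports.

Set Implicit Arguments.
Unset Strict Implicit.
Unset Printing Implicit Defensive.

Local Open Scope classical_set_scope.
Local Open Scope ring_scope.

(** Vectors of R^p are row vectors ['rV[R]_p].  Their library topology is the
    usual one, but their library norm is the sup norm; the Euclidean norm is
    therefore defined separately, from the standard inner product. *)

Definition dotp (R : realType) (p : nat) (x y : 'rV[R]_p) : R :=
  \sum_(j < p) x 0 j * y 0 j.

Definition enorm (R : realType) (p : nat) (x : 'rV[R]_p) : R :=
  Num.sqrt (dotp x x).

Definition B2 (R : realType) (p : nat) : set 'rV[R]_p := [set x | enorm x <= 1].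

Definition dilate (R : realType) (p : nat) (t : R) (C : set 'rV[R]_p) :
  set 'rV[R]_p := [set t *: x | x in C].

Definition convex_body (R : realType) (p : nat) (K : set 'rV[R]_p) : Prop :=
  [/\ compact K, @convex_set R 'rV[R]_p K & interior K !=set0].

Definition centrally_symmetric (R : realType) (p : nat) (K : set 'rV[R]_p) :
  Prop := forall x, K x -> K (- x).

(** [(-1) ^+ eps j] with [eps j : bool] ranges over the signs {-1, 1}. *)
Definition sign_perm_invariant (R : realType) (p : nat) (K : set 'rV[R]_p) :
  Prop :=
  forall (x : 'rV[R]_p) (eps : 'I_p -> bool) (pi : {perm 'I_p}),
    K x -> K (\row_j ((-1) ^+ eps j * x 0 (pi j))).

Definition nnz (R : realType) (p : nat) (v : 'rV[R]_p) : nat :=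
  #|[set j | v 0 j != 0]|%SET.

Definition conv (R : realType) (p : nat) (A : set 'rV[R]_p) : set 'rV[R]_p :=
  smallest (@convex_set R 'rV[R]_p) A.

Definition sparse_hull (R : realType) (p : nat) (K : set 'rV[R]_p) (s : nat) :
  set 'rV[R]_p := conv [set v | K v /\ (nnz v <= s)%N].

Definition polar (R : realType) (p : nat) (C : set 'rV[R]_p) : set 'rV[R]_p :=
  [set y | forall x, C x -> dotp x y <= 1].

(** Real [inf] and [sup] default to 0 on sets without a finite bound; below
    they are only used where the set is nonempty and bounded. *)
Definition gauge (R : realType) (p : nat) (C : set 'rV[R]_p) (y : 'rV[R]_p) : R :=
  inf [set t : R | 0 < t /\ dilate t C y].

Definition support_fun (R : realType) (p : nat) (C : set 'rV[R]_p)
  (z : 'rV[R]_p) : R := sup [set dotp z v | v in C].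

Definition restrict_to (R : realType) (p : nat) (T : {set 'I_p})
  (z : 'rV[R]_p) : 'rV[R]_p := \row_j (if j \in T then z 0 j else 0).

(** [T] is a set of indices of the [s] largest coordinates of [z] in absolute
    value.  Ties may make several [T] qualify; a deterministic tie-breaking
    rule is a function [Ts] with [is_top s z (Ts z)] for all [z]. *)
Definition is_top (R : realType) (p : nat) (s : nat) (z : 'rV[R]_p)
  (T : {set 'I_p}) : Prop :=
  #|T| = s /\
  forall i j : 'I_p, i \in T -> j \notin T -> `|z 0 j| <= `|z 0 i|.

(** Such rules exist, e.g. breaking ties in favour of the smaller index
    ([sort] is stable). *)
Lemma is_top_sort (R : realType) (p s : nat) (z : 'rV[R]_p) : (s <= p)%N ->
  is_top s z
    [set i in take s (sort (fun i j => `|z 0 j| <= `|z 0 i|) (enum 'I_p))]%SET.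
Proof.
move=> sp; set r := fun i j : 'I_p => _; set l := sort r _.
have szl : size l = p by rewrite size_sort size_enum_ord.
have ul : uniq l by rewrite sort_uniq enum_uniq.
have rtr : transitive r by move=> y x w /= xy yw; exact: le_trans yw xy.
have : sorted r l by apply: sort_sorted => i j; exact: le_total.
rewrite (sorted_pairwise rtr) -[X in pairwise _ X](cat_take_drop s) pairwise_cat.
case/and3P => /allrelP rl _ _; split.
  rewrite cardsE; have /card_uniqP -> : uniq (take s l) by exact: take_uniq.
  by rewrite size_takel ?szl.
move=> i j; rewrite !inE => iT jT; apply: rl => //.
have : j \in l by rewrite mem_sort mem_enum.
by rewrite -{1}(cat_take_drop s l) mem_cat (negbTE jT).
Qed.

Definition aspect_ratio_le (R : realType) (p : nat) (C : set 'rV[R]_p)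
  (rho : R) : Prop :=
  exists a b : R, [/\ 0 < a, a <= b, b / a <= rho,
    dilate a (@B2 R p) `<=` C & C `<=` dilate b (@B2 R p)].

(* Main.v *)
From Pilot Require Import Defs.
From HB Require Import structures.
From mathcomp Require Import all_boot all_order all_algebra all_fingroup.
From mathcomp Require Import all_classical all_reals all_analysis.
From mathcomp Require Import ring lra.
Import Order.TTheory GRing.Theory Num.Theory.
Import numFieldNormedType.Exports.
Local Open Scope classical_set_scope.
Local Open Scope ring_scope.

(** The gauge of the polar of K is the support function h of K, and sign and
    permutation invariance make h monotone in the absolute values of the
    coordinates and invariant under their permutation; hence among the
    restrictions of z to at most s coordinates, h is largest on the s largest
    ones.  A linear form has the same upper bounds on a set and on its convex
    hull, and on the s-sparse points of K it only sees restrictions of z, which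
    gives the formula.  The outer radius comes from
    |z_S|^2 >= (s/p) |z|^2 for a top set S. *)

(** * Inner products, support functions, gauges and polars of general sets *)

Section SupportFunction.
Context {R : realType} {p : nat}.
Implicit Types (x y z v : 'rV[R]_p) (C : set 'rV[R]_p) (T : {set 'I_p}).

Lemma dotpC x y : dotp x y = dotp y x.
Proof. by apply: eq_bigr => j _; rewrite mulrC. Qed.

Lemma dotpDr z x y : dotp z (x + y) = dotp z x + dotp z y.
Proof. by rewrite -big_split /=; apply: eq_bigr => j _; rewrite mxE mulrDr. Qed.

Lemma dotpZr z (a : R) x : dotp z (a *: x) = a * dotp z x.
Proof. by rewrite mulr_sumr; apply: eq_bigr => j _; rewrite mxE mulrCA. Qed.

Lemma dotpZl z (a : R) x : dotp (a *: x) z = a * dotp x z.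
Proof. by rewrite dotpC dotpZr dotpC. Qed.

Lemma dotp0r z : dotp z 0 = 0.
Proof. by rewrite -(scale0r 0) dotpZr mul0r. Qed.

Lemma dotpp_ge0 x : 0 <= dotp x x.
Proof. by apply: sumr_ge0 => j _; rewrite -expr2 sqr_ge0. Qed.

Lemma B2E x : B2 x <-> dotp x x <= 1.
Proof.
rewrite /B2 /enorm /=; split=> [|h].
  by rewrite -{1}sqrtr1 ler_sqrt // ltr01.
by rewrite -sqrtr1 ler_sqrt // ltr01.
Qed.

(** Summing [2 x_j y_j <= x_j^2 + y_j^2] suffices here, both norms being at most 1. *)
Lemma dotp_le1 x y : B2 x -> B2 y -> dotp x y <= 1.
Proof.
move=> /B2E hx /B2E hy.
suff : 2 * dotp x y <= dotp x x + dotp y y by lra.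
rewrite mulr_sumr -big_split /=; apply: ler_sum => j _.
have := sqr_ge0 (x 0 j - y 0 j); nra.
Qed.

Lemma halfspace_convex z (c : R) :
  @convex_set R 'rV[R]_p [set v | dotp z v <= c].
Proof.
move=> x y t; rewrite !inE /= => hx hy.
have t0 : 0 <= t%:num by [].
have t1 : t%:num <= 1 by [].
rewrite dotpDr !dotpZr /unstable.onem; nra.
Qed.

Lemma conv_halfspace {C z} {c : R} :
  (forall v, Pilot.Defs.conv C v -> dotp z v <= c) <->
  (forall v, C v -> dotp z v <= c).
Proof.
split=> h v Cv; first by apply: h; exact: sub_gen_smallest.
exact: (smallest_sub (halfspace_convex z c) h).
Qed.

Lemma compact_has_ubound_dotp {C} z :
  compact C -> has_ubound [set dotp z v | v in C].
Proof.
(* Boundedness holds for every constant strictly above [M0], hence the [+ 1]; the sup norm then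
   bounds each coordinate. *)
move=> /compact_bounded [M0 [_ /(_ (M0 + 1))]]; rewrite ltrDl ltr01.
move=> /(_ isT); set M := M0 + 1 => hM.
exists (\sum_j `|z 0 j| * M) => _ [v Cv <-]; apply: ler_sum => j _.
apply: (le_trans (ler_norm _)); rewrite normrM ler_wpM2l //.
apply: le_trans (hM v Cv).
have -> : `|v| = mx_norm v by [].
by rewrite mx_normrE; apply: (le_bigmax _ _ (0, j)).
Qed.

(** Replaces [sup] by upper bounds; the two hypotheses exclude its default value 0. *)
Lemma support_fun_leP {C z} {c : R} :
    C !=set0 -> has_ubound [set dotp z v | v in C] ->
  support_fun C z <= c <-> (forall v, C v -> dotp z v <= c).
Proof.
move=> [w Cw] ubC; split=> [h v Cv|h].
  by apply: le_trans h; apply: ub_le_sup => //; exists v.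
apply: ge_sup => [|_ [v Cv <-]]; last exact: h.
by exists (dotp z w), w.
Qed.

Lemma dilate_polarP {C y} {t : R} : 0 < t ->
  dilate t (polar C) y <-> (forall v, C v -> dotp y v <= t).
Proof.
move=> t0; split=> [[w hw <-] v Cv|h].
  by rewrite dotpZl dotpC ger_pMr // hw.
exists (t^-1 *: y); last by rewrite scalerA mulfV ?scale1r // gt_eqF.
by move=> v Cv; rewrite dotpZr dotpC ler_pdivrMl // mulr1 h.
Qed.

(** The admissible [t] are exactly the positive upper bounds of the form [y] on [C], and the least
    upper bound is nonnegative because [0] lies in [C]. *)
Lemma gauge_polar C y : C 0 -> has_ubound [set dotp y v | v in C] ->
  gauge (polar C) y = support_fun C y.
Proof.
move=> C0 ubC.
have C00 : C !=set0 by exists 0.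
have h0 : 0 <= support_fun C y.
  by apply: ub_le_sup => //; exists 0 => //; rewrite dotp0r.
have mem t : 0 < t -> dilate t (polar C) y <-> support_fun C y <= t.
  move=> t0; rewrite (dilate_polarP t0); exact: iff_sym (support_fun_leP C00 ubC).
apply/eqP; rewrite eq_le; apply/andP; split.
  (* The slack [e] is needed since the support function may vanish, whereas [t] must be positive. *)
  apply/ler_addgt0Pr => e e0; apply: ge_inf.
    by exists 0 => t [/ltW].
  have t0 : 0 < support_fun C y + e by rewrite ltr_wpDl.
  by split=> //; apply/mem => //; rewrite lerDl ltW.
apply: lb_le_inf => [|t [t0 /mem]]; last exact.
have t0 : 0 < support_fun C y + 1 by rewrite ltr_wpDl.
by exists (support_fun C y + 1); split=> //; apply/mem => //; rewrite lerDl.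
Qed.

Lemma dotp_restrictr z T v : dotp z (restrict_to T v) = dotp (restrict_to T z) v.
Proof.
by apply: eq_bigr => j _; rewrite !mxE; case: ifP => // _; rewrite mulr0 mul0r.
Qed.

Lemma restrict_to_supp v : restrict_to [set j | v 0 j != 0]%SET v = v.
Proof.
by apply/rowP => j; rewrite mxE inE; case: eqVneq => [->|].
Qed.

Lemma nnz_restrict_to T v : (nnz (restrict_to T v) <= #|T|)%N.
Proof.
apply: subset_leq_card; apply/fintype.subsetP => j.
by rewrite inE mxE; case: ifP => //; rewrite eqxx.
Qed.

End SupportFunction.

(** * Convex bodies invariant under signs and permutations *)

Section InvariantBody.
Context {R : realType} {p : nat} {K : set 'rV[R]_p}.
Hypotheses (hK : convex_body K) (hinv : sign_perm_invariant K).
Implicit Types (x y z v : 'rV[R]_p) (T : {set 'I_p}).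

(** The restriction is the midpoint of [x] and the point obtained from [x] by flipping the signs off
    [T]. *)
Lemma body_restrict_to T x : K x -> K (restrict_to T x).
Proof.
case: hK => _ cK _ Kx.
have Ky := hinv _ (fun j => j \notin T) 1%g Kx.
set y := (X in K X) in Ky.
have half0 : 0 <= 2^-1 :> R by lra.
have half1 : 2^-1 <= 1 :> R by lra.
have := cK x y (Itv01 half0 half1) (mem_set Kx) (mem_set Ky).
move=> /set_mem; congr K; apply/rowP => j; rewrite !mxE perm1 /unstable.onem /=.
by case: (j \in T) => /=; field.
Qed.

Lemma body0 : K 0.
Proof.
have [_ _ [w /interior_subset Kw]] := hK.
have := body_restrict_to finset.set0 _ Kw; congr K.
by apply/rowP => j; rewrite !mxE inE.
Qed.

Lemma body_ubound z : has_ubound [set dotp z v | v in K].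
Proof. by apply: compact_has_ubound_dotp; case: hK. Qed.

Lemma body_supportP {z} {c : R} :
  support_fun K z <= c <-> (forall v, K v -> dotp z v <= c).
Proof. by apply: support_fun_leP (body_ubound z); exists 0; exact: body0. Qed.

Lemma gauge_polar_body z : gauge (polar K) z = support_fun K z.
Proof. exact: gauge_polar body0 (body_ubound z). Qed.

Lemma body_support_ge0 z : 0 <= support_fun K z.
Proof. by rewrite -(dotp0r z); apply: (body_supportP.1 (lexx _)); exact: body0. Qed.

Lemma support_fun_mono y z : (forall j, `|y 0 j| <= `|z 0 j|) ->
  support_fun K y <= support_fun K z.
Proof.
move=> yz; apply/body_supportP => v Kv.
(* These signs turn each [z_j v_j] into [|z_j v_j|], which dominates [y_j v_j]. *)
have := hinv _ (fun j => z 0 j * v 0 j < 0) 1%g Kv.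
move=> /(body_supportP.1 (lexx (support_fun K z))); apply: le_trans.
apply: ler_sum => j _; rewrite mxE perm1 mulrCA -normrEsign normrM.
by apply: (le_trans (ler_norm _)); rewrite normrM ler_wpM2r.
Qed.

Lemma support_fun_perm (pi : {perm 'I_p}) y :
  support_fun K (\row_j y 0 (pi j)) = support_fun K y.
Proof.
(* One inequality for all permutations is enough: applied to the inverse, it gives the other. *)
have le (rho : {perm 'I_p}) (w : 'rV[R]_p) :
    support_fun K (\row_j w 0 (rho j)) <= support_fun K w.
  apply/body_supportP => v Kv.
  have := hinv _ (fun=> false) (rho^-1)%g Kv.
  move=> /(body_supportP.1 (lexx (support_fun K w))); apply: le_trans.
  rewrite /dotp [leRHS](reindex_inj (@perm_inj _ rho)) /=.
  by apply: ler_sum => j _; rewrite !mxE expr0 mul1r permK.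
apply/eqP; rewrite eq_le le /=.
have := le pi^-1%g (\row_j y 0 (pi j)); congr (support_fun K _ <= _).
by apply/rowP => j; rewrite !mxE permKV.
Qed.

(* Induction on #|T :\: S|, trading one index of T :\: S for one of S :\: T. *)
Lemma support_fun_top {s z} {S T} : is_top s z S -> (#|T| <= s)%N ->
  support_fun K (restrict_to T z) <= support_fun K (restrict_to S z).
Proof.
move=> [cS top]; have [n] := ubnP #|T :\: S|; elim: n T => // n IH T.
rewrite ltnS => hn cT; have [TS|] := boolP (T \subset S).
  apply: support_fun_mono => j; rewrite !mxE.
  by case: ifP => [/(fintype.subsetP TS) ->|] //; rewrite normr0.
move=> nTS; have /fintype.subsetPn[i iT iS] := nTS.
(* If [S] were inside [T], the cardinality bound would force equality. *)
have /fintype.subsetPn[k kS kT] : ~~ (S \subset T).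
  apply: contra nTS => ST; have /eqP <- : S == T by rewrite eqEcard ST cS.
  exact: subxx.
have ik : i != k by apply: contraNneq iS => ->.
pose T' := (k |: (T :\ i))%SET.
have cT' : (#|T'| <= s)%N.
  apply: leq_trans cT; rewrite cardsU1 (cardsD1 i T) iT !inE.
  by rewrite leq_add2r leq_b1.
have hT' : (#|T' :\: S| < n)%N.
  apply: leq_trans hn; apply: proper_card; apply/properP; split.
    apply/fintype.subsetP => j; rewrite !inE => /andP[jS /orP[/eqP jk|/andP[_ ->]]].
      by rewrite jk kS in jS.
    by rewrite jS.
  by exists i; rewrite !inE ?iS // eqxx (negbTE ik).
apply: le_trans (IH T' hT' cT').
(* With [i] and [k] transposed, [z_T] is dominated entrywise by [z_{T'}]: it is 0 at [i], and at [k]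
   it carries [z_i], with [|z_i| <= |z_k|] as only [k] is in the top set. *)
rewrite -(support_fun_perm (tperm i k)); apply: support_fun_mono => j.
rewrite !mxE !inE; case: tpermP => [->|->|/eqP ji /eqP jk].
- by rewrite (negbTE kT) normr0.
- by rewrite iT eqxx /= top.
- by rewrite (negbTE jk) ji.
Qed.

Lemma sparse_hullP {s z} {S} {c : R} : is_top s z S ->
  (forall v, sparse_hull K s v -> dotp z v <= c) <->
  support_fun K (restrict_to S z) <= c.
Proof.
move=> top; apply: iff_trans conv_halfspace _; split=> [h|/body_supportP h v].
  apply/body_supportP => v Kv; rewrite -dotp_restrictr; apply: h; split.
    exact: body_restrict_to.
  by case: top => <- _; exact: nnz_restrict_to.
move=> [Kv sv]; rewrite -(restrict_to_supp v) dotp_restrictr.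
apply: (body_supportP.1 _ _ Kv); apply: le_trans (support_fun_top top sv) _.
exact/body_supportP.
Qed.

(** By [sparse_hullP] both sides have the same upper bounds. *)
Lemma support_fun_sparse_hull {s z} {S} : is_top s z S ->
  support_fun (sparse_hull K s) z = support_fun K (restrict_to S z).
Proof.
move=> top; have hull := (sparse_hullP top).2 (lexx _).
have hull0 : sparse_hull K s !=set0.
  exists 0; apply: sub_gen_smallest; split; first exact: body0.
  by rewrite /nnz (eq_card0 (A := _)) // => j; rewrite inE mxE eqxx.
have ub : has_ubound [set dotp z v | v in sparse_hull K s].
  by exists (support_fun K (restrict_to S z)) => _ [v /hull ? <-].
apply/eqP; rewrite eq_le; apply/andP; split.
  exact/(support_fun_leP hull0 ub).
exact/(sparse_hullP top)/(support_fun_leP hull0 ub).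
Qed.

Lemma bigmax_gauge {s z} {S} : is_top s z S ->
  \big[Num.max/0]_(T : {set 'I_p} | (#|T| <= s)%N)
     gauge (polar K) (restrict_to T z) = gauge (polar K) (restrict_to S z).
Proof.
move=> top; apply/eqP; rewrite eq_le; apply/andP; split.
  (* The initial value 0 of the maximum is harmless, the gauges being nonnegative. *)
  apply: bigmax_le => [|T cT]; rewrite !gauge_polar_body.
    exact: body_support_ge0.
  exact: support_fun_top cT.
by apply: le_bigmax_cond; case: top => ->.
Qed.

Lemma polar_sparse_hullP {s z} {S} : is_top s z S ->
  polar (sparse_hull K s) z <-> gauge (polar K) (restrict_to S z) <= 1.
Proof.
move=> top; rewrite gauge_polar_body.
apply: iff_trans (sparse_hullP top).
by split=> h v /h; rewrite dotpC.
Qed.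

(** For nonzero [y], evaluate the form at the point [r y / |y|] of the ball. *)
Lemma support_fun_ball (r : R) y : 0 < r -> dilate r (@B2 R p) `<=` K ->
  r * enorm y <= support_fun K y.
Proof.
move=> r0 rK; have [->|y0] := eqVneq (enorm y) 0.
  by rewrite mulr0 body_support_ge0.
have ey : 0 < enorm y by rewrite lt_neqAle eq_sym y0 sqrtr_ge0.
have eyy : dotp y y = enorm y ^+ 2 by rewrite sqr_sqrtr ?dotpp_ge0.
have -> : r * enorm y = dotp y (r *: ((enorm y)^-1 *: y)).
  by rewrite !dotpZr eyy; field.
apply: (body_supportP.1 (lexx _)); apply: rK; exists ((enorm y)^-1 *: y) => //.
apply/B2E; rewrite dotpZr dotpZl eyy.
by have -> : (enorm y)^-1 * ((enorm y)^-1 * enorm y ^+ 2) = 1 by field.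
Qed.

End InvariantBody.

(* Summing z_j^2 <= z_i^2 over i in S and j outside S. *)
Lemma dotp_top (R : realType) (p s : nat) (z : 'rV[R]_p) (S : {set 'I_p}) :
  is_top s z S ->
  s%:R * dotp z z <= p%:R * dotp (restrict_to S z) (restrict_to S z).
Proof.
move=> [cS top]; set a := fun j => z 0 j ^+ 2.
pose A := \sum_(i in S) a i; pose B := \sum_(i in ~: S) a i.
have -> : dotp z z = A + B.
  rewrite /dotp (bigID (mem S)) /=; congr (_ + _).
  by apply: eq_bigl => j; rewrite inE.
have -> : dotp (restrict_to S z) (restrict_to S z) = A.
  rewrite /A big_mkcond; apply: eq_bigr => j _; rewrite !mxE.
  by case: ifP => // _; rewrite mulr0.
have ps : p%:R = s%:R + #|~: S|%:R :> R by rewrite -natrD -cS cardsC card_ord.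
(* The term [s A] cancels from both sides; what remains compares two double sums over [S] times its
   complement. *)
suff : s%:R * B <= #|~: S|%:R * A by rewrite ps; lra.
have -> : s%:R * B = \sum_(i in S) \sum_(j in ~: S) a j.
  by rewrite sumr_const cS mulr_natl.
have -> : #|~: S|%:R * A = \sum_(i in S) \sum_(j in ~: S) a i.
  by rewrite mulr_sumr; apply: eq_bigr => i _; rewrite sumr_const mulr_natl.
apply: ler_sum => i iS; apply: ler_sum => j; rewrite inE => jS.
by rewrite /a -[leLHS]real_normK ?num_real // -[leRHS]real_normK ?num_real //
  lerXn2r ?nnegrE // top.
Qed.

Lemma dilate_B2 (R : realType) (p : nat) (b : R) (z : 'rV[R]_p) :
  0 < b -> enorm z <= b -> dilate b (@B2 R p) z.
Proof.
move=> b0 zb; exists (b^-1 *: z); last by rewrite scalerA mulfV ?scale1r // gt_eqF.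
have eyy : dotp z z = enorm z ^+ 2 by rewrite sqr_sqrtr ?dotpp_ge0.
apply/B2E; rewrite dotpZr dotpZl eyy mulrA -expr2 -exprMn.
by rewrite exprn_ile1 ?mulr_ge0 ?invr_ge0 ?sqrtr_ge0 ?(ltW b0) // ler_pdivrMl // mulr1.
Qed.

Theorem lemma2p1 (R : realType) (p s : nat) (K : set 'rV[R]_p)
    (Ts : 'rV[R]_p -> {set 'I_p})
    (hs : (1 <= s <= p)%N)
    (hK : convex_body K)
    (hsym : centrally_symmetric K)
    (hinv : sign_perm_invariant K)
    (hTs : forall z : 'rV[R]_p, is_top s z (Ts z)) :
  [/\ forall z : 'rV[R]_p,
        support_fun (sparse_hull K s) z =
          \big[Num.max/0]_(T : {set 'I_p} | (#|T| <= s)%N)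
             gauge (polar K) (restrict_to T z) /\
        \big[Num.max/0]_(T : {set 'I_p} | (#|T| <= s)%N)
             gauge (polar K) (restrict_to T z) =
          gauge (polar K) (restrict_to (Ts z) z),
      polar (sparse_hull K s) =
        [set z : 'rV[R]_p | gauge (polar K) (restrict_to (Ts z) z) <= 1] &
      forall r R0 : R, 0 < r -> r <= R0 ->
        dilate r (@B2 R p) `<=` K -> K `<=` dilate R0 (@B2 R p) ->
        [/\ dilate (1 / R0) (@B2 R p) `<=` polar (sparse_hull K s),
            polar (sparse_hull K s) `<=`
              dilate (1 / r * Num.sqrt (p%:R / s%:R)) (@B2 R p) &
            aspect_ratio_le (polar (sparse_hull K s))
              (R0 / r * Num.sqrt (p%:R / s%:R))]].
Proof.
have polarE : polar (sparse_hull K s) =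
    [set z : 'rV[R]_p | gauge (polar K) (restrict_to (Ts z) z) <= 1].
  by apply/seteqP; split=> z /= /(polar_sparse_hullP hK hinv (hTs z)).
split=> // [z|r R0 r0 rR0 rK KR].
  split; last exact: bigmax_gauge.
  rewrite (bigmax_gauge hK hinv (hTs z)) gauge_polar_body //.
  exact: support_fun_sparse_hull.
have [s0 sp] := andP hs.
have R0_gt0 := lt_le_trans r0 rR0.
have sR : 0 < s%:R :> R by rewrite ltr0n.
have spR : s%:R <= p%:R :> R by rewrite ler_nat.
have q1 : 1 <= Num.sqrt (p%:R / s%:R) :> R.
  by rewrite -{1}sqrtr1 ler_wsqrtr // ler_pdivlMr // mul1r.
set b := 1 / r * _.
have b0 : 0 < b by rewrite mulr_gt0 ?divr_gt0 // (lt_le_trans ltr01).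
have inner : dilate (1 / R0) (@B2 R p) `<=` polar (sparse_hull K s).
  (* It suffices to test sparse points of [K]; there the factors [1 / R0] and [R0] cancel. *)
  move=> _ [y By <-] v hv; rewrite dotpC; move: v hv; apply/conv_halfspace.
  move=> v [/KR [w Bw <-] _]; rewrite dotpZr dotpZl mulrA div1r.
  by rewrite mulfV ?mul1r ?dotp_le1 // gt_eqF.
have outer : polar (sparse_hull K s) `<=` dilate b (@B2 R p).
  move=> z /(polar_sparse_hullP hK hinv (hTs z)).
  rewrite gauge_polar_body // => h1.
  apply: dilate_B2 => //.
  have := le_trans (support_fun_ball hK hinv _ _ r0 rK) h1.
  set y := restrict_to _ z => ry.
  (* The square root of [dotp_top]; it combines with [r |y| <= 1]. *)
  have zy : enorm z <= Num.sqrt (p%:R / s%:R) * enorm y.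
    rewrite /enorm -sqrtrM ?divr_ge0 ?ler0n //; apply: ler_wsqrtr.
    by rewrite mulrAC ler_pdivlMr // mulrC dotp_top.
  apply: le_trans zy _; rewrite /b mulrC ler_wpM2r ?sqrtr_ge0 //.
  by rewrite ler_pdivlMr // mulrC.
split=> //; exists (1 / R0), b; split=> //.
- by rewrite divr_gt0.
(* The chain is [1 / R0 <= 1 / r <= b], the last step by [q1]. *)
- apply: (@le_trans _ _ (1 / r)); first by rewrite !mul1r lef_pV2.
  by rewrite ler_peMr // divr_ge0 // ltW.
- by rewrite /b le_eqVlt; apply/orP; left; apply/eqP; field; rewrite !gt_eqF.
Qed.
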